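(* Let $n\ge 3$. For every $m\ge 2$ and every pair of distinct indices $i,j\in\{1,\dots,n\}$, one has $$\tau_{ij}(\bar a_n,\bar b_n)=I_n+\bar E_{ij}\in\mathrm{SL}_n(\mathbb Z/m\mathbb Z).$$ In particular, $\bar a_n$ and $\bar b_n$ generate $\mathrm{SL}_n(\mathbb Z/m\mathbb Z)$.
   Context: $E_{i,j}$ is the standard $n\times n$ matrix unit and $\bar E_{ij}$ its reduction modulo $m$; $[x,y]=x^{-1}y^{-1}xy$; $\varepsilon_n=(-1)^{n-1}$; $$a_n=\sum_{i=1}^{n-1}E_{i,i+1}+\varepsilon_nE_{n,1},\qquad b_n=I_n+E_{2,1}.$$ $\bar a_n,\bar b_n$ are the images of $a_n,b_n\in\mathrm{SL}_n(\mathbb Z)$ under reduction modulo $m$, $\mathrm{SL}_n(\mathbb Z)\to\mathrm{SL}_n(\mathbb Z/m\mathbb Z)$. The words $\tau_{ij}=\tau_{i,j}=\tau_{ij}(a,b)$ in the free group on $a,b$ ($1\le i\ne j\le n$) are defined as follows. Step 1: $\tau_{r+1,r}:=a^{-(r-1)}ba^{r-1}$ for $1\le r\le n-1$, and $\tau_{1n}:=\bigl(a^{-(n-1)}ba^{n-1}\bigr)^{\varepsilon_n}$. Step 2: for $d=2,\dots,n-1$ successively and all $i,j$ with $i-j=d$, $\tau_{ij}:=[\tau_{i,j+1},\tau_{j+1,j}]$. Step 3: for $2\le i\le n-1$, $\tau_{in}:=[\tau_{i1},\tau_{1n}]$. Step 4: for $1\le i<j\le n-1$, $\tau_{ij}:=[\tau_{in},\tau_{nj}]$.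 *)

(* Defs.v *)
From HB Require Import structures.
From mathcomp Require Import all_boot all_order all_algebra all_fingroup.
Set Implicit Arguments.
Unset Strict Implicit.
Unset Printing Implicit Defensive.
Import GRing.Theory.
Local Open Scope ring_scope.

Section SpecialLinear.
Variables (n : nat) (R : comNzRingType).

Record SL : predArgType := MkSL { SLval :> 'M[R]_n; _ : \det SLval == 1 }.

HB.instance Definition _ := [isSub for SLval].
HB.instance Definition _ := [Choice of SL by <:].

Implicit Types A B C : SL.

Lemma SL_det A : \det (val A) = 1. Proof. exact/eqP/(valP A). Qed.

Fact SL_one_subproof : \det (1%:M : 'M[R]_n) == 1.
Proof. by rewrite det1. Qed.

Fact SL_mul_subproof A B : \det (val A *m val B) == 1.
Proof. by rewrite det_mulmx !SL_det mulr1. Qed.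

Fact SL_inv_subproof A : \det (\adj (val A)) == 1.
Proof.
have := congr1 determinant (mul_adj_mx (val A)).
by rewrite det_mulmx SL_det mulr1 det1 => ->.
Qed.

Definition SL_one := MkSL SL_one_subproof.
Definition SL_mul A B := MkSL (SL_mul_subproof A B).
Definition SL_inv A := MkSL (SL_inv_subproof A).

Fact SL_mulA : associative SL_mul.
Proof. by move=> A B C; apply: val_inj; rewrite /= mulmxA. Qed.

Fact SL_mul1 : left_id SL_one SL_mul.
Proof. by move=> A; apply: val_inj; rewrite /= mul1mx. Qed.

Fact SL_mulr1 : right_id SL_one SL_mul.
Proof. by move=> A; apply: val_inj; rewrite /= mulmx1. Qed.

Fact SL_mulV : left_inverse SL_one SL_inv SL_mul.
Proof. by move=> A; apply: val_inj; rewrite /= mul_adj_mx SL_det. Qed.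

Fact SL_mulrV : right_inverse SL_one SL_inv SL_mul.
Proof. by move=> A; apply: val_inj; rewrite /= mul_mx_adj SL_det. Qed.

HB.instance Definition _ :=
  isGroup.Build SL SL_mulA SL_mul1 SL_mulr1 SL_mulV SL_mulrV.

End SpecialLinear.

HB.instance Definition _ (n : nat) (R : finComNzRingType) :=
  [Finite of SL n R by <:].

Fact SL_map_subproof n (R S : comNzRingType) (f : {rmorphism R -> S})
  (A : SL n R) : \det (map_mx f (val A)) == 1.
Proof. by rewrite det_map_mx SL_det rmorph1. Qed.

Definition SL_map n (R S : comNzRingType) (f : {rmorphism R -> S}) (A : SL n R) :
  SL n S := MkSL (SL_map_subproof f A).

(* Indices are 1-based; for i or j outside 1..n the matrix is 0. *)
Definition E (n i j : nat) : 'M[int]_n :=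
  \matrix_(k, l) ((k.+1 == i) && (l.+1 == j))%:R.

Definition eps (n : nat) : int := (-1) ^+ n.-1.

Definition a_mx (n : nat) : 'M[int]_n :=
  \sum_(1 <= i < n) E n i i.+1 + eps n *: E n n 1.

Definition b_mx (n : nat) : 'M[int]_n := 1%:M + E n 2 1.

Lemma a_mx_entry n (k l : 'I_n) :
  a_mx n k l = (l == k.+1 :> nat)%:R + eps n * ((k.+1 == n) && (l == 0 :> nat))%:R.
Proof.
rewrite !mxE eqSS summxE; congr (_ + _).
have [lk|lk] := eqVneq (l : nat) k.+1; last first.
  rewrite big_nat big1 // => i _; rewrite mxE eqSS.
  by case: eqP => // <-; rewrite (negbTE lk).
have kn : (k.+1 < n)%N by rewrite -lk.
rewrite (bigD1_seq k.+1) ?mem_index_iota ?iota_uniq //= mxE eqxx lk eqxx.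
by rewrite big1 ?addr0 // => i /negbTE ik; rewrite mxE eq_sym ik.
Qed.

Fact a_det n : \det (a_mx n) == 1.
Proof.
case: n => [|n]; first by rewrite det_mx00.
rewrite (expand_det_col _ ord0) (bigD1 ord_max) //= big1 ?addr0; last first.
  move=> i ni; rewrite a_mx_entry /= add0r eqSS.
  by rewrite -[n]/(nat_of_ord (@ord_max n)) val_eqE (negbTE ni) mulr0 mul0r.
rewrite a_mx_entry /= !eqxx add0r mulr1 /cofactor.
suff -> : row' ord_max (col' ord0 (a_mx n.+1)) = 1%:M.
  by rewrite det1 mulr1 addn0 /eps /= -exprD addnn -signr_odd odd_double.
apply/matrixP => i j; rewrite !mxE -[_ + _ * _]addrC.
have := a_mx_entry (lift ord_max i) (lift ord0 j).
rewrite !mxE addrC => ->; rewrite lift_max /= /bump /= add1n eqSS.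
by rewrite andbF mulr0 addr0 eq_sym.
Qed.

Fact b_det n : \det (b_mx n) == 1.
Proof.
rewrite det_trig.
  by rewrite big1 // => i _; rewrite !mxE eqxx !eqSS; case: (i : nat) => [|[]].
apply/is_trig_mxP => i j ij; rewrite !mxE !eqSS.
case: eqP ij => [->|_]; first by rewrite ltnn.
by case: eqP => [->|//]; case: eqP => [->|].
Qed.

Definition a_ (n : nat) : SL n int := MkSL (a_det n).
Definition b_ (n : nat) : SL n int := MkSL (b_det n).

Definition redm (m : nat) : {rmorphism int -> 'Z_m} := intr.

Definition abar (n m : nat) : SL n 'Z_m := SL_map (redm m) (a_ n).
Definition bbar (n m : nat) : SL n 'Z_m := SL_map (redm m) (b_ n).

(* A word represents an element of the free group on a, b.  A letter is a pair
   (generator, exponent sign): generator false is a, true is b; sign true is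
   the inverse.  Words need not be reduced, which does not affect [weval]. *)
Definition word := seq (bool * bool).
Definition wa : word := [:: (false, false)].
Definition wb : word := [:: (true, false)].
Definition winv (w : word) : word := rev [seq (l.1, ~~ l.2) | l <- w].
Definition wpow (w : word) (z : int) : word :=
  match z with
  | Posz k => flatten (nseq k w)
  | Negz k => flatten (nseq k.+1 (winv w))
  end.
Definition wcomm (x y : word) : word := winv x ++ winv y ++ x ++ y.

Definition weval (G : groupType) (x y : G) (w : word) : G :=
  (\prod_(l <- w) let g := if l.1 then y else x in if l.2 then g^-1 else g)%g.

(* a^{-k} b a^k *)
Definition wconj (k : nat) : word := wpow wa (- k%:Z) ++ wb ++ wpow wa k%:Z.

(* tau_low d j is tau_{j+d,j}, for d >= 1. *)
Fixpoint tau_low (d j : nat) : word :=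
  match d with
  | 0 => [::]
  | 1 => wconj j.-1
  | d'.+1 => wcomm (tau_low d' j.+1) (wconj j.-1)
  end.

Definition tau_1n (n : nat) : word := wpow (wconj n.-1) (eps n).

Definition tau_last (n i : nat) : word :=
  if i == 1 then tau_1n n else wcomm (tau_low i.-1 1) (tau_1n n).

(* Meaningful for i <> j in 1..n. *)
Definition tau (n i j : nat) : word :=
  if (j < i)%N then tau_low (i - j) j
  else if j == n then tau_last n i
  else wcomm (tau_last n i) (tau_low (n - j) j).

(* Main.v *)
Require Import Defs.
From mathcomp Require Import all_boot all_order all_algebra all_fingroup.
Set Implicit Arguments.
Unset Strict Implicit.
Unset Printing Implicit Defensive.
Import GRing.Theory.
Local Open Scope ring_scope.

(** The identities for the words hold already in SL_n(Z).  Right multiplication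
by a_n sends the i-th basis row vector to the next one, and the last to
eps_n times the first, so conjugation by a_n shifts both indices of I + E_{ij}
by one ([SLval_conj_a]), a sign appearing only when the last index wraps
around to the first ([SLval_conj_a_last]).  Conjugating b_n = I + E_{21} by
powers of a_n therefore gives the subdiagonal elementary matrices and
I + eps_n E_{1n}, whose power eps_n is I + E_{1n}.  All the other words are
commutators, evaluated by [I + E_{ij}, I + E_{jk}] = I + E_{ik} for distinct
i, j, k ([SLval_comm_elem]).  Reduction modulo m is a group morphism, so it
commutes with evaluating words.

It remains to see that the matrices I + E_{ij} generate SL_n(Z/m)
([elementary_generate_SL]).  Since every residue is a multiple of 1, their
powers are the I + t E_{ij} for all t, so all row operations are available.
The columns are made standard one after the other.  Euclid's algorithm on
the representatives in 0..m-1 leaves a single nonzero entry in the rows from k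
on of column k ([euclid_column]); pairing with row k of the inverse matrix
shows that this entry is a unit ([pivot_unit]).  Row operations through another
row turn the diagonal entry into 1, or, in the last column, the determinant
already says that it is 1 ([pivot_one]); the rest of the column is then
cleared ([clear_column]).  Euclid's algorithm and the clearing are phrased as
the choice of a matrix in a finite coset with smallest column sum
([column_minimal]): a further reduction step would contradict minimality. *)

(** * Evaluation of words *)

Section Words.
Variables (G : groupType) (x y : G).
Local Notation ev := (weval x y).
Local Open Scope group_scope.

Lemma weval_cat u v : ev (u ++ v) = ev u * ev v.
Proof. by rewrite /weval big_cat. Qed.

Lemma weval_inv w : ev (winv w) = (ev w)^-1.
Proof.
elim: w => [|[g s] w IH]; first by rewrite /weval /winv /= big_nil invg1.
rewrite -cat1s weval_cat invMg -IH /winv map_cat rev_cat weval_cat; congr (_ * _).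
by rewrite /weval !big_seq1; case: s; rewrite /= ?invgK.
Qed.

Lemma weval_flatten_nseq w k : ev (flatten (nseq k w)) = ev w ^+ k.
Proof.
elim: k => [|k IH]; first by rewrite /weval big_nil expg0.
by rewrite /= weval_cat IH expgS.
Qed.

Lemma weval_comm u v : ev (wcomm u v) = [~ ev u, ev v].
Proof. by rewrite /wcomm !weval_cat !weval_inv. Qed.

Lemma weval_conj k : ev (wconj k) = y ^ (x ^+ k).
Proof.
have evx : ev wa = x by rewrite /weval big_seq1.
have evy : ev wb = y by rewrite /weval big_seq1.
rewrite /wconj !weval_cat evy [ev (wpow wa k)]weval_flatten_nseq evx conjgE.
congr (_ * _); case: k => [|k]; first by rewrite /weval big_nil expg0 invg1.
by rewrite [LHS]weval_flatten_nseq weval_inv evx expgVn.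
Qed.

End Words.

Lemma weval_morph (G H : groupType) (f : G -> H) (x y : G) w :
    (forall u v, f (u * v)%g = (f u * f v)%g) ->
  f (weval x y w) = weval (f x) (f y) w.
Proof.
move=> fM; have f1 : f 1%g = 1%g.
  by apply: (@mulIg _ (f 1%g)); rewrite -fM !mul1g.
have fV u : f (u^-1)%g = ((f u)^-1)%g.
  by apply: (@mulIg _ (f u)); rewrite -fM !mulVg.
rewrite /weval; elim: w => [|[[] []] w IH]; rewrite ?big_nil //;
  by rewrite !big_cons fM IH ?fV.
Qed.

(** * Matrix units and the matrix a_n *)

Section MatrixUnits.
Variable n : nat.
Local Notation E := (E n).
Implicit Types i j k l : nat.

Lemma E_delta (i j : 'I_n) : E i.+1 j.+1 = delta_mx i j.
Proof. by apply/matrixP => k l; rewrite !mxE !eqSS. Qed.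

Lemma E_mul i j l : (1 <= j <= n)%N -> E i j *m E j l = E i l.
Proof.
case: j => // j /= jn; apply/matrixP => r s; rewrite !mxE (bigD1 (Ordinal jn)) //=.
rewrite !mxE !eqxx big1 ?addr0 ?andbT -?natrM ?mulnb // => t /eqP tj.
rewrite !mxE eqSS andbC; case: eqP => [tj'|_]; last by rewrite mul0r.
by case: tj; apply: val_inj.
Qed.

Lemma E_mul0 i j k l : j <> k -> E i j *m E k l = 0.
Proof.
move=> jk; apply/matrixP => r s; rewrite !mxE big1 // => t _; rewrite !mxE.
case: (t.+1 =P j) => [->|_]; last by rewrite andbF mul0r.
by rewrite (introF eqP jk) mulr0.
Qed.

Lemma E_mul_a i j : (1 <= j < n)%N -> E i j *m a_mx n = E i j.+1.
Proof.
move=> /andP[j0 jn]; rewrite mulmxDr -scalemxAr E_mul0 ?scaler0 ?addr0; last first.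
  by move=> jE; rewrite {1}jE ltnn in jn.
rewrite mulmx_sumr (bigD1_seq j) ?mem_index_iota ?iota_uniq ?j0 //=.
rewrite E_mul ?j0 1?ltnW // big1 ?addr0 // => k /eqP kj.
by rewrite E_mul0 // => /esym.
Qed.

Lemma a_mul_E i j : (1 <= i < n)%N -> a_mx n *m E i.+1 j = E i j.
Proof.
move=> /andP[i0 i_n]; rewrite mulmxDl -scalemxAl E_mul0 ?scaler0 ?addr0; last first.
  by case=> i1; rewrite -i1 in i0.
rewrite mulmx_suml (bigD1_seq i) ?mem_index_iota ?iota_uniq ?i0 //=.
rewrite E_mul ?i_n // big1 ?addr0 // => k /eqP ki.
by rewrite E_mul0 // => -[].
Qed.

Lemma a_mul_E_first j : (0 < n)%N -> a_mx n *m E 1 j = eps n *: E n j.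
Proof.
move=> n0; rewrite mulmxDl -scalemxAl E_mul ?n0 //=.
rewrite mulmx_suml big_nat big1 ?add0r // => k /andP[k0 _].
by rewrite E_mul0 // => -[k1]; rewrite k1 in k0.
Qed.

End MatrixUnits.

(** * Elementary matrices as values of the words, over the integers *)

Lemma SLval_mul n (R : comNzRingType) (x y : SL n R) :
  SLval (x * y)%g = SLval x *m SLval y.
Proof. by []. Qed.

(** The inverse in [SL] is given by the adjugate, which is unpleasant to compute
with; this avoids it in the evaluation of inverses, conjugates and
commutators. *)
Lemma SLval_cancel n (R : comNzRingType) (x y : SL n R) (M : 'M[R]_n) :
  SLval x *m M = SLval (x * y)%g -> SLval y = M.
Proof.
move=> xM; rewrite -[y](mulKg x) -[RHS]mul1mx.
by rewrite -[1%:M]/(SLval (1%g : SL n R)) -(mulVg x) /= -mulmxA xM.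
Qed.

Section ElementaryInSLZ.
Variable n : nat.
Local Notation E := (E n).
Implicit Types (x y : SL n int) (i j k : nat) (c : int).

Lemma SLval_inv_elem x i j c : i <> j ->
  SLval x = 1%:M + c *: E i j -> SLval (x^-1)%g = 1%:M - c *: E i j.
Proof.
move=> ij xE; apply: (@SLval_cancel _ _ x); rewrite mulgV xE mulmxBr mulmx1.
rewrite mulmxDl mul1mx -scalemxAl -scalemxAr E_mul0; last exact: nesym.
by rewrite !scaler0 addr0 addrK.
Qed.

(** With [e = E i j] and [f = E j k], both sides of
[(1 + f) (1 + e) (1 + E i k) = (1 + e) (1 + f)] are [1 + e + f + E i k], since
[e f = E i k] and the other products of these matrix units vanish. *)
Lemma SLval_comm_elem x y i j k : (1 <= j <= n)%N -> i <> j -> j <> k -> i <> k ->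
    SLval x = 1%:M + E i j -> SLval y = 1%:M + E j k ->
  SLval [~ x, y]%g = 1%:M + E i k.
Proof.
move=> j1n ij jk ik xE yE.
apply: (@SLval_cancel _ _ (y * x)%g).
have -> : (y * x * [~ x, y])%g = (x * y)%g by rewrite -commgC.
rewrite /= xE yE !mulmxDl !mulmxDr !mul1mx !mulmx1 !mulmxDl !mul1mx.
rewrite E_mul // !(@E_mul0 _ _ k) ?(@E_mul0 _ _ j) //; try exact: nesym.
rewrite mul0mx !addr0 -!addrA; congr (_ + _).
by rewrite addrA [RHS]addrC.
Qed.

Lemma SLval_conj_a x i j : (1 <= i < n)%N -> (1 <= j < n)%N ->
  SLval x = 1%:M + E i j -> SLval (x ^ a_ n)%g = 1%:M + E i.+1 j.+1.
Proof.
move=> i_n j_n xE; apply: (@SLval_cancel _ _ (a_ n)).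
rewrite -conjgC /= xE mulmxDr [(1%:M + _) *m _]mulmxDl mulmx1 mul1mx.
by rewrite a_mul_E // E_mul_a.
Qed.

(** Here the row index wraps around: [a_mx n *m E 1 n] is [eps n *: E n n], and
[eps n] is its own inverse. *)
Lemma SLval_conj_a_last x j : (1 < n)%N ->
  SLval x = 1%:M + E n n.-1 -> SLval (x ^ a_ n)%g = 1%:M + eps n *: E 1 n.
Proof.
move=> n1 xE; apply: (@SLval_cancel _ _ (a_ n)); have n0 := ltnW n1.
rewrite -conjgC /= xE mulmxDr [(1%:M + _) *m _]mulmxDl mulmx1 mul1mx.
rewrite -scalemxAr a_mul_E_first //.
rewrite E_mul_a; last by case: (n) n1 => [|[]] //= k _; rewrite leqnn.
by rewrite prednK // scalerA -expr2 /eps sqrr_sign scale1r.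
Qed.

Local Notation tau_val w := (SLval (weval (a_ n) (b_ n) w)).

Lemma tau_val_conj k : (k.+1 < n)%N -> tau_val (wconj k) = 1%:M + E k.+2 k.+1.
Proof.
rewrite weval_conj; elim: k => [|k IH] kn; first by rewrite expg0 conjg1.
rewrite expgSr conjgM.
by apply: SLval_conj_a (IH (ltnW kn)); [exact: kn | exact: ltnW].
Qed.

Lemma tau_val_conj_last : (1 < n)%N ->
  tau_val (wconj n.-1) = 1%:M + eps n *: E 1 n.
Proof.
move=> n1; have [k nE] : exists k, n = k.+2 by case: n n1 => [|[|k]] // _; exists k.
have kE : n.-1 = k.+1 by rewrite nE.
rewrite kE weval_conj expgSr conjgM; apply: SLval_conj_a_last => //.
by rewrite -weval_conj tau_val_conj ?kE nE.
Qed.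

Lemma tau_val_1n : (1 < n)%N -> tau_val (tau_1n n) = 1%:M + E 1 n.
Proof.
move=> n1; have n_1 : 1%N <> n by move=> n_1; rewrite -n_1 in n1.
have xE := tau_val_conj_last n1; rewrite /tau_1n; move: xE.
rewrite /eps -signr_odd; case: odd => xE.
  rewrite [wpow _ _]/= cats0 weval_inv (SLval_inv_elem n_1 xE).
  by rewrite expr1 scaleN1r opprK.
by rewrite [wpow _ _]/= cats0 xE expr0 scale1r.
Qed.

Lemma tau_val_low d j : (0 < d)%N -> (0 < j)%N -> (j + d <= n)%N ->
  tau_val (tau_low d j) = 1%:M + E (j + d) j.
Proof.
case: d => // d _; elim: d j => [|d IH] [|j] // _ jd.
  by rewrite addn1 in jd *; apply: tau_val_conj.
rewrite [tau_low _ _]/= -/(tau_low d.+1 j.+2) weval_comm.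
have jd1 : (j.+1 + d.+2 = j.+2 + d.+1)%N by rewrite !addSn !addnS.
have jn : (j.+2 < n)%N by apply: leq_trans jd; rewrite addSn !addnS !ltnS leq_addr.
rewrite jd1 in jd *; apply: SLval_comm_elem (IH _ _ jd) (tau_val_conj _) => //.
- by rewrite /= ltnW.
- by move/eqP; rewrite -[X in _ == X]addn0 eqn_add2l.
- by move/eqP; rewrite eqn_leq ltnn.
- by move/eqP; rewrite addSnnS -[X in _ == X]addn0 eqn_add2l.
- by rewrite ltnW.
Qed.

Lemma tau_val_last i : (0 < i < n)%N -> tau_val (tau_last n i) = 1%:M + E i n.
Proof.
move=> /andP[i0 i_n]; have n1 : (1 < n)%N by apply: leq_trans i_n.
rewrite /tau_last; case: eqP => [->|i1]; first exact: tau_val_1n.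
have i_pos : (0 < i.-1)%N by case: i i0 i1 {i_n} => [|[]].
rewrite weval_comm.
have lowE := @tau_val_low i.-1 1 i_pos isT; rewrite add1n prednK // in lowE.
apply: SLval_comm_elem (lowE (ltnW i_n)) (tau_val_1n n1) => //.
- exact: ltnW n1.
- by move=> n_1; rewrite -n_1 in n1.
- by move=> i_eq; rewrite i_eq ltnn in i_n.
Qed.

Lemma tau_val_elementary i j :
    (1 <= i <= n)%N -> (1 <= j <= n)%N -> i <> j ->
  tau_val (tau n i j) = 1%:M + E i j.
Proof.
move=> /andP[i0 i_n] /andP[j0 j_n] ij; rewrite /tau.
case: (ltngtP j i) ij => [ji|ij|->] // _.
  by rewrite tau_val_low ?subn_gt0 // subnKC // ltnW.
have i_lt : (i < n)%N by apply: leq_trans j_n.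
case: eqP => [->|jn]; first by rewrite tau_val_last ?i0.
have j_lt : (j < n)%N by rewrite ltn_neqAle j_n andbT; apply/eqP.
rewrite weval_comm; have lowE := @tau_val_low (n - j) j.
rewrite subnKC // subn_gt0 in lowE.
apply: SLval_comm_elem (lowE j_lt j0 (leqnn n));
  rewrite ?tau_val_last ?i0 ?leqnn ?(ltn_trans i0) //.
- by move=> i_eq; rewrite i_eq ltnn in i_lt.
- exact: nesym.
- by move=> i_eq; rewrite i_eq ltnn in ij.
Qed.

End ElementaryInSLZ.

(** * Elementary matrices generate SL_n(Z/m) *)

Section ElementaryGeneration.
Variables (n m : nat).
Hypothesis m_gt1 : (1 < m)%N.
Local Notation SLm := (SL n 'Z_m).
Implicit Types (A B C g : SLm) (i j k p q l : 'I_n) (t x y : 'Z_m).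

Variable H : {group SLm}.
Hypothesis H_elem : forall i j, i != j ->
  exists2 g, g \in H & SLval g = 1%:M + delta_mx i j.

Lemma transvection_in i j t : i != j ->
  exists2 g, g \in H & SLval g = 1%:M + t *: delta_mx i j.
Proof.
move=> ij; have [g gH gE] := H_elem ij; exists (g ^+ (t : nat))%g.
  exact: groupX.
rewrite -[t in RHS]natr_Zp scaler_nat.
elim: (t : nat) => [|s IH]; first by rewrite expg0 mulr0n addr0.
rewrite expgSr SLval_mul IH gE mulmxDl mul1mx mulmxDr mulmx1 mulrSr -scaler_nat.
by rewrite -scalemxAl mul_delta_mx_0 1?eq_sym // scaler0 addr0 addrAC addrA.
Qed.

Definition identity_cols (k : nat) A :=
  [forall l : 'I_n, (l < k)%N ==> [forall i, SLval A i l == (i == l)%:R]].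

Lemma identity_colsP (k : nat) A :
  reflect (forall i l, (l < k)%N -> SLval A i l = (i == l)%:R) (identity_cols k A).
Proof.
apply: (iffP forallP) => [Ak i l lk | Ak l].
  by have /forallP/(_ i)/eqP := implyP (Ak l) lk.
by apply/implyP => lk; apply/forallP => i; rewrite Ak.
Qed.

(** Left multiplication by [1 + t E_{ji}] adds [t] times row [i] to row [j]; the
first [k] columns survive because row [i], with [k <= i], vanishes on them. *)
Lemma row_op (k : nat) A i j t : (k <= i)%N -> i != j -> identity_cols k A ->
  exists B, [/\ (B \in H :* A)%g, identity_cols k B &
    forall p l, SLval B p l = SLval A p l + (p == j)%:R * t * SLval A i l].
Proof.
move=> ki ij Ak; have [|g gH gE] := @transvection_in j i t; first by rewrite eq_sym.
have gA p l : SLval (g * A)%g p l = SLval A p l + (p == j)%:R * t * SLval A i l.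
  rewrite SLval_mul gE mulmxDl mul1mx mxE; congr (_ + _).
  rewrite -scalemxAl mxE mxE (bigD1 i) //= big1 ?addr0.
    by rewrite mxE eqxx andbT mulrA [t * _]mulrC.
  by move=> q /negbTE qi; rewrite mxE qi andbF mul0r.
exists (g * A)%g; split=> //; first by rewrite mem_rcoset mulgK.
apply/identity_colsP => p l lk; rewrite gA !(identity_colsP _ _ Ak) //.
have /negbTE-> : i != l by apply: contraTneq lk => <-; rewrite -leqNgt.
by rewrite mulr0 addr0.
Qed.

Lemma coset_trans A B C : (B \in H :* A)%g -> (C \in H :* B)%g -> (C \in H :* A)%g.
Proof. by move=> /rcoset_eqP <-. Qed.

(** Termination of the reduction algorithms: among the matrices of the coset
satisfying [Q], choose one with the smallest sum over the rows in [P] of the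
representatives in column [k].  No operation preserving [Q] and changing
column [k] in a single row of [P] can then lower the entry there. *)
Lemma column_minimal (Q : pred SLm) (P : pred 'I_n) A k : Q A ->
  exists B, [/\ (B \in H :* A)%g, Q B &
    forall C j, (C \in H :* B)%g -> Q C -> P j ->
      (forall p, p != j -> SLval C p k = SLval B p k) ->
      (SLval B j k <= SLval C j k)%N].
Proof.
move=> QA; pose PQ := [pred B | (B \in H :* A)%g && Q B].
have PQA : PQ A by rewrite /= rcoset_refl.
have [B /andP[BA QB] Bmin] :=
  arg_minnP (fun B => \sum_(p | P p) (SLval B p k : nat))%N PQA.
exists B; split=> // C j CB QC Pj CBeq.
have := Bmin C; rewrite /= QC (coset_trans BA CB) => /(_ isT).
rewrite (bigD1 j) //= [in X in (_ <= X)%N](bigD1 j) //=.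
rewrite [X in (_ <= _ + X)%N](eq_bigr (fun p => SLval B p k : nat)) ?leq_add2r //.
by move=> p /andP[_ /CBeq->].
Qed.

Lemma Zp_subn x y : (y <= x)%N -> (x - y : 'Z_m) = (x - y)%N :> nat.
Proof.
move=> yx; rewrite -[x in LHS]natr_Zp -[y in LHS]natr_Zp -natrB //.
rewrite val_Zp_nat // modn_small // -[X in (_ < X)%N](Zp_cast m_gt1).
by apply: leq_ltn_trans (ltn_ord x); apply: leq_subr.
Qed.

(** If the entries of two rows from [k] on were nonzero, subtracting the smaller
from the larger would lower the column sum. *)
Lemma euclid_column k A : identity_cols k A -> exists B p,
  [/\ (B \in H :* A)%g, identity_cols k B, (k <= p)%N &
      forall q, (k <= q)%N -> q != p -> SLval B q k = 0].
Proof.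
move=> Ak; have [B [BA Bk Bmin]] :=
  @column_minimal (identity_cols k) (fun p => k <= p)%N _ k Ak.
have le_absurd p q : (k <= p)%N -> (k <= q)%N -> p != q -> SLval B p k != 0 ->
    (SLval B p k <= SLval B q k)%N -> False.
  move=> kp kq pq Bp leBpq.
  have [C [CB Ck CE]] := row_op (-1) kp pq Bk.
  have := Bmin C q CB Ck kq; rewrite CE eqxx mul1r mulN1r Zp_subn // leqNgt.
  have Bp0 : (0 < SLval B p k)%N by rewrite lt0n.
  rewrite ltn_subrL Bp0 (leq_trans Bp0 leBpq) => Ceq.
  suff /Ceq : forall r, r != q -> SLval C r k = SLval B r k by [].
  by move=> r /negbTE rq; rewrite CE rq !mul0r addr0.
have [p /andP[kp Bp] | none] := pickP (fun p => (k <= p)%N && (SLval B p k != 0)).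
  exists B, p; split=> // q kq qp; apply/eqP/negPn/negP => Bq.
  case: (leqP (SLval B p k) (SLval B q k)) => [|/ltnW] le_pq.
    by apply: le_absurd le_pq; rewrite // eq_sym.
  exact: le_absurd le_pq.
exists B, k; split=> // q kq _; apply/eqP/negPn/negP => Bq.
by have := none q; rewrite kq Bq.
Qed.

(** The columns before [k] of [A] being standard, row [k] of [A^-1] vanishes on
them; its product with column [k] of [A], which equals [1], then has [A p k] as
a factor of its only nonzero term. *)
Lemma pivot_unit k A p : identity_cols k A -> (k <= p)%N ->
    (forall q, (k <= q)%N -> q != p -> SLval A q k = 0) ->
  SLval A p k \is a GRing.unit.
Proof.
move=> Ak kp Aq; have [V VA] : exists V, V *m SLval A = 1%:M.
  by exists (SLval (A^-1)%g); rewrite -SLval_mul mulVg.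
have Vk q : (q < k)%N -> V k q = 0.
  move=> qk; have := congr1 (fun M : 'M_n => M k q) VA; rewrite !mxE (bigD1 q) //=.
  rewrite (identity_colsP _ _ Ak) // eqxx mulr1 big1 ?addr0 => [->|r /negbTE rq].
    by rewrite -val_eqE gtn_eqF.
  by rewrite (identity_colsP _ _ Ak) // rq mulr0.
apply/unitrPr; exists (V k p); have := congr1 (fun M : 'M_n => M k k) VA.
rewrite !mxE eqxx (bigD1 p) //= big1 ?addr0 1?mulrC // => q qp.
by case: (leqP k q) => [kq|/Vk->]; rewrite ?mul0r // Aq // mulr0.
Qed.

(** When [k] is the last column, [A] is upper triangular with determinant the
pivot itself.  Otherwise a unit [u] is placed strictly below the diagonal, and
adding [(1 - A k k) / u] times its row to row [k] makes the diagonal entry 1. *)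
Lemma pivot_one k A : identity_cols k A ->
  exists B, [/\ (B \in H :* A)%g, identity_cols k B & SLval B k k = 1].
Proof.
move=> Ak; have [k_last|] := eqVneq k.+1 n.
  exists A; split=> //; first exact: rcoset_refl.
  have trigA : is_trig_mx (SLval A)^T.
    apply/is_trig_mxP => i j ij; rewrite mxE (identity_colsP _ _ Ak).
      by rewrite -val_eqE gtn_eqF.
    by apply: leq_trans ij _; rewrite -ltnS k_last.
  have := SL_det A; rewrite -det_tr det_trig // (bigD1 k) //=.
  rewrite big1 ?mulr1 ?mxE // => i ik.
  rewrite mxE (identity_colsP _ _ Ak) ?eqxx // ltn_neqAle -ltnS k_last ltn_ord andbT.
  exact: ik.
move=> kn; have {kn} kn : (k.+1 < n)%N by rewrite ltn_neqAle kn ltn_ord.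
have [B [p [BA Bk kp Bq]]] := euclid_column Ak.
have Bu := pivot_unit Bk kp Bq.
(* A unit on the diagonal is copied to the next row, whose entry is 0. *)
have [C [q [CA Ck kq Cu]]] : exists C q,
    [/\ (C \in H :* A)%g, identity_cols k C, (k < q)%N & SLval C q k \is a GRing.unit].
  have [pk|pk] := eqVneq p k; last first.
    by exists B, p; split=> //; rewrite ltn_neqAle kp eq_sym val_eqE pk.
  rewrite pk in Bq Bu; pose q := Ordinal kn.
  have kq : k != q by rewrite -val_eqE /= ltn_eqF.
  have [C [CB Ck CE]] := row_op 1 (leqnn k) kq Bk.
  exists C, q; split=> //; first exact: coset_trans CB.
  by rewrite CE eqxx !mul1r Bq ?add0r 1?eq_sym // leqnSn.
have qk : q != k by rewrite -val_eqE gtn_eqF.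
have [D [DC Dk DE]] := row_op ((1 - SLval C k k) / SLval C q k) (ltnW kq) qk Ck.
exists D; split=> //; first exact: coset_trans DC.
by rewrite DE eqxx mul1r divrK // addrC subrK.
Qed.

(** With pivot [1], subtracting [A i k] times row [k] from row [i] replaces the
entry [A i k] by 0, so minimality forces that entry to be 0 already. *)
Lemma clear_column k A : identity_cols k A ->
  exists2 B, (B \in H :* A)%g & identity_cols k.+1 B.
Proof.
move=> Ak; have [B [BA Bk Bkk]] := pivot_one Ak.
pose Q C := identity_cols k C && (SLval C k k == 1).
have [|C [CB /andP[Ck /eqP Ckk] Cmin]] := @column_minimal Q (fun p => p != k) B k.
  by rewrite /Q Bk Bkk eqxx.
exists C; first exact: coset_trans CB.
apply/identity_colsP => i l; rewrite ltnS leq_eqVlt => /orP[|lk].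
  2: exact: (identity_colsP _ _ Ck).
rewrite val_eqE => /eqP->; have [-> //|ik] := eqVneq i k.
have ki : k != i by rewrite eq_sym.
have [D [DC Dk DE]] := row_op (- SLval C i k) (leqnn k) ki Ck.
have Dkk : SLval D k k = 1 by rewrite DE (negbTE ki) !mul0r addr0.
have := Cmin D i DC; rewrite /Q Dk Dkk eqxx => /(_ isT ik).
rewrite DE eqxx mul1r Ckk mulr1 subrr leqn0 => Ci0.
apply/val_inj/eqP/Ci0 => p /negbTE pi.
by rewrite DE pi !mul0r addr0.
Qed.

Theorem elementary_generate_SL : H = [set: SLm] :> {set SLm}.
Proof.
apply/setP => A; rewrite inE.
have reduce r : (r <= n)%N -> exists2 B, (B \in H :* A)%g & identity_cols r B.
  elim: r => [_|r IH rn].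
    by exists A; [exact: rcoset_refl | apply/identity_colsP].
  have [B BA Br] := IH (ltnW rn).
  have [C CB Cr] := @clear_column (Ordinal rn) B Br.
  by exists C => //; apply: coset_trans CB.
have [B BA Bn] := reduce n (leqnn n).
have B1 : B = 1%g.
  by apply: val_inj; apply/matrixP => i j; rewrite mxE (identity_colsP _ _ Bn).
by move: BA; rewrite B1 mem_rcoset mul1g groupV.
Qed.

End ElementaryGeneration.

Theorem proposition5p1 (n : nat) (hn : (3 <= n)%N) (m : nat) (hm : (2 <= m)%N) :
  (forall i j : nat, (1 <= i <= n)%N -> (1 <= j <= n)%N -> i <> j ->
     SLval (weval (abar n m) (bbar n m) (tau n i j))
       = 1%:M + map_mx (redm m) (E n i j))
  /\ (<<[set abar n m; bbar n m]>>)%g = [set: SL n 'Z_m].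
Proof.
have tauE i j : (1 <= i <= n)%N -> (1 <= j <= n)%N -> i <> j ->
    SLval (weval (abar n m) (bbar n m) (tau n i j))
      = 1%:M + map_mx (redm m) (E n i j).
  move=> i_n j_n ij; rewrite -(@weval_morph _ _ (SL_map (redm m))).
    by rewrite /= tau_val_elementary // map_mxD map_mx1.
  by move=> u v; apply: val_inj; rewrite /= map_mxM.
split=> //; apply: elementary_generate_SL => // i j ij.
exists (weval (abar n m) (bbar n m) (tau n i.+1 j.+1)); last first.
  rewrite tauE ?ltn_ord ?E_delta ?map_delta_mx // => -[/val_inj/eqP].
  exact/negP.
rewrite /weval; apply: group_prod => -[g s] _ /=.
by case: g; case: s; rewrite ?groupV mem_gen // !inE eqxx ?orbT.
Qed.
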